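(* Let $\gamma$ be a smooth nondegenerate curve in the equi-affine plane, parametrised by equi-affine arc-length $s$, with equi-affine curvature $\kappa$. Then $\gamma$ is a critical point of $\int\kappa\,\mathrm{d}s$ under area constraint, without being an unconstrained critical point of $\int\kappa\,\mathrm{d}s$, if and only if there exist a point $O$ (origin) and a constant $c\neq 0$ such that the equi-affine support function of $\gamma$ with respect to $O$ satisfies $\rho_O=c\,\kappa$.
   Context: The equi-affine plane is $\mathbb{R}^2$ with area form $|u,v|=\det(u,v)$. The curve satisfies $|\gamma',\gamma''|=1$; primes denote $s$-derivatives; $T=\gamma'$, $N=\gamma''$, and $\kappa$ is defined by $\gamma'''=-\kappa\gamma'$. For a point $O$, write the position vector $P=\gamma-O=-\rho_O\,N+\phi\,T$; the function $\rho_O=|P,T|$ is the equi-affine support function with respect to $O$. Variations are smooth and compactly supported; a variation with variation vector field $f\,N+g\,T$ changes the (enclosed, signed) area to first order by $\delta\,\mathrm{Area}=-\int f\,\mathrm{d}s$. The curve is a critical point of $\int\kappa\,\mathrm{d}s$ under area constraint if there is a constant $\lambda$ with $\delta\int\kappa\,\mathrm{d}s=\lambda\,\delta\,\mathrm{Area}$ for all such variations; it is an unconstrained critical point if $\delta\int\kappa\,\mathrm{d}s=0$ for all such variations. *)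

(* Defs.v *)
From Stdlib Require Import Reals Lra List.
From Coquelicot Require Import Coquelicot.
Open Scope R_scope.

Definition R2 := (R * R)%type.
Definition det (u v : R2) : R := fst u * snd v - snd u * fst v.
Definition vsub (u v : R2) : R2 := (fst u - fst v, snd u - snd v).
Definition vscal (k : R) (u : R2) : R2 := (k * fst u, k * snd u).

Definition inI (a b : Rbar) (s : R) : Prop := Rbar_lt a s /\ Rbar_lt s b.

Definition Dn (n : nat) (g : R -> R2) (s : R) : R2 :=
  (Derive_n (fun u => fst (g u)) n s, Derive_n (fun u => snd (g u)) n s).

Definition smooth_curve (a b : Rbar) (g : R -> R2) : Prop :=
  forall (n : nat) (s : R), inI a b s ->
    ex_derive_n (fun u => fst (g u)) n s /\ ex_derive_n (fun u => snd (g u)) n s.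

Definition pd (dir : bool) (F : R -> R -> R) : R -> R -> R :=
  if dir then fun t s => Derive (fun t' => F t' s) t
  else fun t s => Derive (fun s' => F t s') s.
Fixpoint pdw (w : list bool) (F : R -> R -> R) : R -> R -> R :=
  match w with nil => F | d :: w' => pdw w' (pd d F) end.

Definition smooth2 (dom : R -> R -> Prop) (F : R -> R -> R) : Prop :=
  forall (w : list bool) (t s : R), dom t s ->
    continuous (fun p : R * R => pdw w F (fst p) (snd p)) (t, s) /\
    ex_derive (fun t' => pdw w F t' s) t /\
    ex_derive (fun s' => pdw w F t s') s.

Definition dv (c : R -> R2) (u : R) : R2 :=
  (Derive (fun v => fst (c v)) u, Derive (fun v => snd (c v)) u).

(** For an arbitrarily parametrised nondegenerate curve c(u):
    ds/du = sigma = |c_u, c_uu|^(1/3),  T = dc/ds = c_u / sigma,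
    N = dT/ds = T_u / sigma, and, since gamma''' = -kappa gamma' gives
    kappa = |N, dN/ds|, the integrand kappa ds = |N, N_u| du. *)
Definition sigma (c : R -> R2) (u : R) : R := Rpower (det (dv c u) (dv (dv c) u)) (1/3).
Definition Tan (c : R -> R2) (u : R) : R2 := vscal (/ sigma c u) (dv c u).
Definition Nor (c : R -> R2) (u : R) : R2 := vscal (/ sigma c u) (dv (Tan c) u).

Definition TotCurv (c : R -> R2) (x y : R) : R :=
  RInt (fun u => det (Nor c u) (dv (Nor c) u)) x y.

Definition AreaTerm (c : R -> R2) (x y : R) : R :=
  RInt (fun u => / 2 * det (c u) (dv c u)) x y.

Definition is_variation (a b : Rbar) (gamma : R -> R2) (eps : R)
    (Gam : R -> R -> R2) (x y : R) : Prop :=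
  0 < eps /\ Rbar_lt a x /\ x <= y /\ Rbar_lt y b /\
  smooth2 (fun t s => - eps < t < eps /\ inI a b s) (fun t s => fst (Gam t s)) /\
  smooth2 (fun t s => - eps < t < eps /\ inI a b s) (fun t s => snd (Gam t s)) /\
  (forall s, inI a b s -> Gam 0 s = gamma s) /\
  (forall t s, - eps < t < eps -> inI a b s -> (s < x \/ y < s) -> Gam t s = gamma s).

Definition delta_TotCurv (Gam : R -> R -> R2) (x y : R) : R :=
  Derive (fun t => TotCurv (Gam t) x y) 0.
Definition delta_Area (Gam : R -> R -> R2) (x y : R) : R :=
  Derive (fun t => AreaTerm (Gam t) x y) 0.

Definition constrained_critical (a b : Rbar) (gamma : R -> R2) : Prop :=
  exists lam : R, forall eps Gam x y, is_variation a b gamma eps Gam x y ->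
    delta_TotCurv Gam x y = lam * delta_Area Gam x y.

Definition unconstrained_critical (a b : Rbar) (gamma : R -> R2) : Prop :=
  forall eps Gam x y, is_variation a b gamma eps Gam x y ->
    delta_TotCurv Gam x y = 0.

Definition support_fn (O : R2) (gamma : R -> R2) (s : R) : R :=
  det (vsub (gamma s) O) (Dn 1 gamma s).

(* Main.v *)
Require Import Defs.
From Stdlib Require Import Reals Lra List.
From Coquelicot Require Import Coquelicot.
Open Scope R_scope.

(** Write m = |V, T| for a variation field V, so that V = f N + g T has m = - f.
    Integrating the linearised integrand by parts gives
    delta int kappa ds = - 2/3 int (kappa'' + kappa^2) m ds and
    delta Area = int m ds. Testing against V = beta N with a bump function beta,
    gamma is critical under area constraint iff kappa'' + kappa^2 is a constant
    mu, with multiplier lambda = - 2/3 mu, and is unconstrained critical iff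
    mu = 0. On the other hand a support function satisfies rho'' + kappa rho = 1,
    so rho = c kappa forces mu = 1/c; conversely, if mu <> 0 and
    rho = kappa / mu, the point gamma + rho N - rho' T does not move with s
    and has support function rho. *)

(** * Differentiation under the integral sign *)

(** For t different from 0 the curves [Gam t] are no longer parametrised by equi-affine arc length,
    so the integrand has to be expressed for an arbitrary parametrisation, through four derivatives
    of the curve and fractional powers of D = |c_u, c_uu|. This is meaningful only where D > 0; as D
    = 1 at t = 0 and [x, y] is compact, it holds on a whole strip around t = 0. Since [Derive] is
    total, both first variations must be exhibited as genuine derivatives of integrals, which rests
    on joint continuity in (t, s).

    That only m = |V, T| survives reflects invariance under reparametrisation: a tangential field
    moves the curve along itself to first order. A variation is stationary outside [x, y] but need
    not be so near the endpoints inside, so the boundary terms are killed by continuity from the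
    outside.

    No regularity of kappa is assumed; it comes from kappa = |N, N'|. Being critical under
    constraint but not unconstrained means a nonzero multiplier, which is what allows the division
    by mu in the construction of the centre. *)

Definition uc (f : R -> R -> R) : R * R -> R := fun p => f (fst p) (snd p).

Lemma inI_open a b s : inI a b s -> locally s (inI a b).
Proof.
  intros [H1 H2].
  apply filter_and; [apply (open_Rbar_gt a s H1) | apply (open_Rbar_lt b s H2)].
Qed.

Lemma inI_between a b x y s : inI a b x -> inI a b y -> x <= s <= y -> inI a b s.
Proof.
  intros [H1 _] [_ H2] [H3 H4]; split.
  - now apply Rbar_lt_le_trans with x.
  - now apply Rbar_le_lt_trans with y.
Qed.

Lemma inI_inhabited a b : Rbar_lt a b -> exists s, inI a b s.
Proof.
  intros H. destruct a as [a| |], b as [b| |]; try easy; unfold inI.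
  - exists ((a + b) / 2). simpl in *; lra.
  - exists (a + 1). simpl in *; lra.
  - exists (b - 1). simpl in *; lra.
  - exists 0. simpl; auto.
Qed.

Definition dom (a b : Rbar) (eps t s : R) : Prop := - eps < t < eps /\ inI a b s.

Definition open2 (U : R -> R -> Prop) :=
  forall t s, U t s -> locally (t, s) (fun p : R * R => U (fst p) (snd p)).

Lemma dom_open a b eps : open2 (dom a b eps).
Proof.
  intros t s [Ht Hs].
  assert (H1 : locally t (fun u => - eps < u < eps)).
  { apply filter_and; [apply open_gt | apply open_lt]; lra. }
  destruct H1 as [e1 H1]. destruct (inI_open _ _ _ Hs) as [e2 H2].
  assert (Hm : 0 < Rmin e1 e2) by (apply Rmin_pos; [apply e1 | apply e2]).
  exists (mkposreal _ Hm). intros [t' s'] [B1 B2]; split; simpl in *.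
  - apply H1. eapply ball_le; [| exact B1]. apply Rmin_l.
  - apply H2. eapply ball_le; [| exact B2]. apply Rmin_r.
Qed.

Lemma open2_fst U t s : open2 U -> U t s -> locally t (fun t' => U t' s).
Proof.
  intros HU H. destruct (HU _ _ H) as [e He]. exists e. intros t' B.
  apply (He (t', s)). split; [exact B | apply ball_center].
Qed.

Lemma open2_snd U t s : open2 U -> U t s -> locally s (fun s' => U t s').
Proof.
  intros HU H. destruct (HU _ _ H) as [e He]. exists e. intros s' B.
  apply (He (t, s')). split; [apply ball_center | exact B].
Qed.

Lemma continuous_slice (f : R -> R -> R) t s :
  continuous (uc f) (t, s) -> continuous (f t) s.
Proof.
  intros H.
  apply (continuous_comp (fun s' => (t, s')) (uc f)); [| exact H].
  intros P [e He]. exists e. intros s' B. apply He. split; [apply ball_center | exact B].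
Qed.

Lemma continuous_snd_lift (f : R -> R) (t s : R) :
  continuous f s -> continuous (uc (fun _ s' => f s')) (t, s).
Proof.
  intros H. apply (continuous_comp snd f); [apply continuous_snd | exact H].
Qed.

Lemma continuous_fst_lift (f : R -> R) (t s : R) :
  continuous f t -> continuous (uc (fun t' _ => f t')) (t, s).
Proof.
  intros H. apply (continuous_comp fst f); [apply continuous_fst | exact H].
Qed.

Lemma continuous_ext_open2 U (f g : R -> R -> R) t s :
  open2 U -> U t s -> (forall t s, U t s -> f t s = g t s) ->
  continuous (uc f) (t, s) -> continuous (uc g) (t, s).
Proof.
  intros HU H E Hf. apply continuous_ext_loc with (uc f); [| exact Hf].
  eapply filter_imp; [| exact (HU _ _ H)]. intros p Hp. now apply E.
Qed.

(** This is what differentiation under the integral sign requires, in a form stable under sums,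
    products and powers. With [df] as an explicit argument, the derivative of a compound integrand
    is assembled by applying these rules to an unknown [df]. *)
Definition C1t (U : R -> R -> Prop) (f df : R -> R -> R) : Prop :=
  forall t s, U t s ->
    continuous (uc f) (t, s) /\ is_derive (fun z => f z s) t (df t s) /\
    continuous (uc df) (t, s).

Lemma C1t_scal U k f df :
  C1t U f df -> C1t U (fun t s => k * f t s) (fun t s => k * df t s).
Proof.
  intros H t s Hts. destruct (H _ _ Hts) as (A & B & C). split; [| split].
  - apply (continuous_scal_r (k : R_AbsRing) (uc f)), A.
  - apply (is_derive_scal (fun z => f z s)), B.
  - apply (continuous_scal_r (k : R_AbsRing) (uc df)), C.
Qed.

Lemma C1t_plus U f df g dg :
  C1t U f df -> C1t U g dg ->
  C1t U (fun t s => f t s + g t s) (fun t s => df t s + dg t s).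
Proof.
  intros H1 H2 t s Hts.
  destruct (H1 _ _ Hts) as (A & B & C), (H2 _ _ Hts) as (A' & B' & C').
  split; [| split].
  - apply (continuous_plus (uc f) (uc g)); assumption.
  - apply (is_derive_plus (fun z => f z s) (fun z => g z s)); assumption.
  - apply (continuous_plus (uc df) (uc dg)); assumption.
Qed.

Lemma C1t_minus U f df g dg :
  C1t U f df -> C1t U g dg ->
  C1t U (fun t s => f t s - g t s) (fun t s => df t s - dg t s).
Proof.
  intros H1 H2 t s Hts.
  destruct (H1 _ _ Hts) as (A & B & C), (H2 _ _ Hts) as (A' & B' & C').
  split; [| split].
  - apply (continuous_minus (uc f) (uc g)); assumption.
  - apply (is_derive_minus (fun z => f z s) (fun z => g z s)); assumption.
  - apply (continuous_minus (uc df) (uc dg)); assumption.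
Qed.

Lemma C1t_mult U f df g dg :
  C1t U f df -> C1t U g dg ->
  C1t U (fun t s => f t s * g t s) (fun t s => df t s * g t s + f t s * dg t s).
Proof.
  intros H1 H2 t s Hts.
  destruct (H1 _ _ Hts) as (A & B & C), (H2 _ _ Hts) as (A' & B' & C').
  split; [| split].
  - apply (continuous_mult (uc f) (uc g)); assumption.
  - apply (is_derive_mult (fun z => f z s) (fun z => g z s) t); try assumption.
    intros; apply Rmult_comm.
  - apply (continuous_plus (fun p => uc df p * uc g p) (fun p => uc f p * uc dg p)).
    + apply (continuous_mult (uc df) (uc g)); assumption.
    + apply (continuous_mult (uc f) (uc dg)); assumption.
Qed.

Lemma is_derive_Rpower_l r x :
  0 < x -> is_derive (fun z => Rpower z r) x (r * Rpower x (r - 1)).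
Proof. intros H. apply is_derive_Reals. now apply derivable_pt_lim_power. Qed.

Lemma C1t_Rpower U r f df :
  (forall t s, U t s -> 0 < f t s) -> C1t U f df ->
  C1t U (fun t s => Rpower (f t s) r)
        (fun t s => df t s * (r * Rpower (f t s) (r - 1))).
Proof.
  intros Hp H t s Hts. destruct (H _ _ Hts) as (A & B & C).
  assert (P := Hp _ _ Hts).
  assert (Q : forall q, continuous (uc (fun t s => Rpower (f t s) q)) (t, s)).
  { intros q. apply (continuous_comp (uc f) (fun z => Rpower z q)); [exact A |].
    apply (ex_derive_continuous (fun z => Rpower z q)).
    eexists. now apply is_derive_Rpower_l. }
  split; [apply Q | split].
  - apply (is_derive_comp (fun z => Rpower z r) (fun z => f z s)); [| exact B].
    now apply is_derive_Rpower_l.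
  - apply (continuous_mult (uc df) (uc (fun t s => r * Rpower (f t s) (r - 1)))).
    + exact C.
    + apply (continuous_scal_r (r : R_AbsRing) (uc (fun t s => Rpower (f t s) (r - 1)))), Q.
Qed.

Lemma C1t_sub (U U' : R -> R -> Prop) f df :
  (forall t s, U' t s -> U t s) -> C1t U f df -> C1t U' f df.
Proof. intros H1 H2 t s H. apply H2, H1, H. Qed.

Lemma is_derive_RInt_C1t U f df x y d :
  open2 U -> x <= y -> 0 < d ->
  (forall t s, - d < t < d -> x <= s <= y -> U t s) ->
  C1t U f df ->
  is_derive (fun t => RInt (f t) x y) 0 (RInt (df 0) x y).
Proof.
  intros HU Hxy Hd Hb H.
  assert (L : locally 0 (fun t => - d < t < d)).
  { apply (filter_and (F := locally 0) (fun t => - d < t) (fun t => t < d));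
      [apply open_gt | apply open_lt]; lra. }
  replace (RInt (df 0) x y) with (RInt (fun s => Derive (fun u => f u s) 0) x y).
  2: { apply RInt_ext. rewrite Rmin_left, Rmax_right by lra. intros s Hs.
       apply is_derive_unique. apply H, Hb; lra. }
  apply (is_derive_RInt_param f x y 0); rewrite ?Rmin_left, ?Rmax_right by lra.
  - eapply filter_imp; [| exact L]. intros t Ht s Hs. eexists. apply H, Hb; lra.
  - intros s Hs. assert (U0 : U 0 s) by (apply Hb; lra).
    apply continuity_2d_pt_filterlim.
    apply (continuous_ext_open2 U df (fun u v => Derive (fun z => f z v) u) 0 s HU U0).
    + intros u v Huv. symmetry. apply is_derive_unique. now apply H.
    + now apply H.
  - eapply filter_imp; [| exact L]. intros t Ht.
    apply (@ex_RInt_continuous R_CompleteNormedModule).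
    rewrite ?Rmin_left, ?Rmax_right by lra.
    intros s Hs. apply continuous_slice. apply H, Hb; lra.
Qed.

(** * Mixed partial derivatives and the curvature integrand *)

Lemma smooth2_pd U F d : smooth2 U F -> smooth2 U (pd d F).
Proof. intros H w. exact (H (d :: w)). Qed.

Lemma smooth2_continuous U F t s : smooth2 U F -> U t s -> continuous (uc F) (t, s).
Proof. intros H Hts. apply (H nil t s Hts). Qed.

Lemma smooth2_C1t U F : smooth2 U F -> C1t U F (pd true F).
Proof.
  intros H t s Hts. split; [| split].
  - now apply (smooth2_continuous U).
  - apply Derive_correct, (H nil t s Hts).
  - apply (smooth2_continuous U); [now apply smooth2_pd | exact Hts].
Qed.

Lemma smooth2_is_derive_snd U F t s :
  smooth2 U F -> U t s -> is_derive (F t) s (pd false F t s).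
Proof. intros H Hts. apply Derive_correct, (H nil t s Hts). Qed.

Lemma pd_comm U F t s :
  open2 U -> smooth2 U F -> U t s ->
  pd true (pd false F) t s = pd false (pd true F) t s.
Proof.
  intros HU H Hts. apply (Schwarz F t s).
  - apply locally_2d_locally. eapply filter_imp; [| exact (HU _ _ Hts)].
    intros [u v] Huv; simpl in *.
    split; [apply (H nil u v Huv) |]. split; [apply (H nil u v Huv) |].
    split; [apply (H (false :: nil) u v Huv) | apply (H (true :: nil) u v Huv)].
  - apply continuity_2d_pt_filterlim.
    now apply (smooth2_continuous U (pd true (pd false F))); [do 2 apply smooth2_pd |].
  - apply continuity_2d_pt_filterlim.
    now apply (smooth2_continuous U (pd false (pd true F))); [do 2 apply smooth2_pd |].
Qed.

Definition dsn (n : nat) (F : R -> R -> R) : R -> R -> R := Nat.iter n (pd false) F.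

Lemma dsn_Derive_n n F t s : dsn n F t s = Derive_n (F t) n s.
Proof.
  revert s; induction n as [| n IH]; intros s; [reflexivity |].
  apply Derive_ext. exact IH.
Qed.

Lemma smooth2_dsn U F n : smooth2 U F -> smooth2 U (dsn n F).
Proof. intros H. induction n as [| n IH]; [exact H | now apply smooth2_pd]. Qed.

(** Schwarz's theorem, iterated: the first-order change of the n-th s-derivative of a variation is
    the n-th derivative of its variation field. Openness of [U] makes the induction hypothesis an
    identity near s, which may then be differentiated. *)
Lemma dsn_pd_true U F n t s :
  open2 U -> smooth2 U F -> U t s -> pd true (dsn n F) t s = dsn n (pd true F) t s.
Proof.
  intros HU H. revert t s. induction n as [| n IH]; intros t s Hts; [reflexivity |].
  change (pd true (pd false (dsn n F)) t s = pd false (dsn n (pd true F)) t s).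
  rewrite (pd_comm U) by (auto using smooth2_dsn).
  apply Derive_ext_loc. eapply filter_imp; [| exact (open2_snd _ _ _ HU Hts)].
  intros v Hv. now apply IH.
Qed.

Lemma dsn_is_derive U F n t s :
  smooth2 U F -> U t s -> is_derive (dsn n F t) s (dsn (S n) F t s).
Proof. intros H Hts. apply (smooth2_is_derive_snd U (dsn n F)); auto using smooth2_dsn. Qed.

(** Meant for the endpoints x and y, which are limits of points where the variation field and all
    its derivatives vanish. *)
Lemma continuous_zero_adherent (f : R -> R) (x : R) :
  continuous f x -> (forall e : posreal, exists z : R, ball x e z /\ f z = 0) -> f x = 0.
Proof.
  intros Hc Hz. destruct (Req_dec (f x) 0) as [E | E]; [exact E | exfalso].
  assert (L : locally x (fun z => f z <> 0)) by (apply (Hc (fun z => z <> 0)), (open_neq 0 _ E)).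
  destruct L as [e He]. destruct (Hz e) as (z & B & Z). exact (He z B Z).
Qed.

(* [auto_derive] leaves eta-expanded functions under [Derive]. *)
Ltac rewrite_derive H :=
  match type of H with
    is_derive ?f _ _ => rewrite (is_derive_unique (fun x : R => f x) _ _ H)
  end.

(* The integrand |N, N_u| of an arbitrary parametrisation c(u), with
   [(pk, qk)] the k-th derivative c_k: D^(-4/3) (4/3 |c_2,c_3| + 1/3 |c_1,c_4|)
   - 5/9 D^(-7/3) |c_1,c_3|^2 where D = |c_1,c_2|. *)
Definition density (p1 p2 p3 p4 q1 q2 q3 q4 : R) : R :=
  Rpower (p1 * q2 - q1 * p2) (-4/3) *
    (4/3 * (p2 * q3 - q2 * p3) + 1/3 * (p1 * q4 - q1 * p4))
  - 5/9 * (Rpower (p1 * q2 - q1 * p2) (-7/3) *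
             ((p1 * q3 - q1 * p3) * (p1 * q3 - q1 * p3))).

(** With w = 1/sigma = D^(-1/3), the vectors T, N and N_u have coefficients polynomial in w and the
    c_k, because w' = -1/3 D' w^4. The relation D w^3 = 1 then lowers the degree to that of
    [density]. [V] is open so that identities valid on it can be differentiated. *)
Lemma density_correct (V : R -> Prop) (c : R -> R2) (p q : nat -> R -> R) :
  (forall v, V v -> locally v V) ->
  (forall v, fst (c v) = p O v) -> (forall v, snd (c v) = q O v) ->
  (forall n v, V v -> is_derive (p n) v (p (S n) v)) ->
  (forall n v, V v -> is_derive (q n) v (q (S n) v)) ->
  (forall v, V v -> 0 < p 1%nat v * q 2%nat v - q 1%nat v * p 2%nat v) ->
  forall v, V v ->
  det (Nor c v) (dv (Nor c) v) =
  density (p 1%nat v) (p 2%nat v) (p 3%nat v) (p 4%nat v)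
          (q 1%nat v) (q 2%nat v) (q 3%nat v) (q 4%nat v).
Proof.
  intros HV Ep Eq Hp Hq HD.
  assert (loc : forall (f g : R -> R) l v, V v -> (forall v, V v -> f v = g v) ->
                  is_derive g v l -> Derive f v = l).
  { intros f g l v Hv E H. apply is_derive_unique.
    apply is_derive_ext_loc with g; [| exact H].
    eapply filter_imp; [| exact (HV v Hv)]. intros u Hu. symmetry. now apply E. }
  set (D := fun v => p 1%nat v * q 2%nat v - q 1%nat v * p 2%nat v) in *.
  (* [D1] is D': the other term of the product rule is |c_2, c_2| = 0. *)
  set (D1 := fun v => p 1%nat v * q 3%nat v - q 1%nat v * p 3%nat v).
  set (w := fun v => Rpower (D v) (-1/3)).
  assert (E1 : forall v, V v -> dv c v = (p 1%nat v, q 1%nat v)).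
  { intros v Hv. unfold dv. f_equal.
    - eapply loc; [exact Hv | intros; apply Ep | now apply Hp].
    - eapply loc; [exact Hv | intros; apply Eq | now apply Hq]. }
  assert (E2 : forall v, V v -> dv (dv c) v = (p 2%nat v, q 2%nat v)).
  { intros v Hv. unfold dv at 1. f_equal.
    - eapply loc; [exact Hv | intros u Hu; rewrite (E1 u Hu); reflexivity | now apply Hp].
    - eapply loc; [exact Hv | intros u Hu; rewrite (E1 u Hu); reflexivity | now apply Hq]. }
  assert (Es : forall v, V v -> / Defs.sigma c v = w v).
  { intros v Hv. unfold Defs.sigma, w. rewrite E1, E2 by assumption.
    unfold det, D; simpl. rewrite <- Rpower_Ropp. f_equal. field. }
  assert (HD1 : forall v, V v -> is_derive D v (D1 v)).
  { intros v Hv. unfold D, D1.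
    assert (A1 := Hp 1%nat v Hv). assert (A2 := Hp 2%nat v Hv).
    assert (B1 := Hq 1%nat v Hv). assert (B2 := Hq 2%nat v Hv).
    auto_derive.
    - repeat split; eexists; eassumption.
    - rewrite_derive A1; rewrite_derive A2; rewrite_derive B1; rewrite_derive B2. ring. }
  set (D2 := fun v => p 2%nat v * q 3%nat v - q 2%nat v * p 3%nat v +
                      (p 1%nat v * q 4%nat v - q 1%nat v * p 4%nat v)).
  assert (HD2 : forall v, V v -> is_derive D1 v (D2 v)).
  { intros v Hv. unfold D1, D2.
    assert (A1 := Hp 1%nat v Hv). assert (A2 := Hp 3%nat v Hv).
    assert (B1 := Hq 1%nat v Hv). assert (B2 := Hq 3%nat v Hv).
    auto_derive.
    - repeat split; eexists; eassumption.
    - rewrite_derive A1; rewrite_derive A2; rewrite_derive B1; rewrite_derive B2. ring. }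
  assert (W4 : forall v, Rpower (D v) (-4/3) = w v ^ 4).
  { intros v. unfold w. simpl. rewrite Rmult_1_r, <- !Rpower_plus. f_equal. field. }
  assert (W7 : forall v, Rpower (D v) (-7/3) = w v ^ 7).
  { intros v. unfold w. simpl. rewrite Rmult_1_r, <- !Rpower_plus. f_equal. field. }
  assert (WD : forall v, V v -> D v * w v ^ 3 = 1).
  { intros v Hv. assert (P := HD v Hv : 0 < D v).
    transitivity (Rpower (D v) (1 + (-1/3 + (-1/3 + -1/3)))).
    - rewrite !Rpower_plus, Rpower_1 by exact P. unfold w. ring.
    - etransitivity; [| exact (Rpower_O _ P)]. f_equal. field. }
  assert (Hw : forall v, V v -> is_derive w v (- (1/3) * D1 v * w v ^ 4)).
  { intros v Hv. unfold w at 1.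
    replace (- (1/3) * D1 v * w v ^ 4)
      with (scal (D1 v) (-1/3 * Rpower (D v) (-1/3 - 1))).
    - apply (is_derive_comp (fun z => Rpower z (-1/3)) D); [| now apply HD1].
      apply is_derive_Rpower_l, HD, Hv.
    - rewrite <- W4. replace (-1/3 - 1) with (-4/3) by lra.
      change (D1 v * (-1/3 * Rpower (D v) (-4/3)) = - (1/3) * D1 v * Rpower (D v) (-4/3)).
      field. }
  assert (HT : forall v, V v -> Tan c v = (w v * p 1%nat v, w v * q 1%nat v)).
  { intros v Hv. unfold Tan. now rewrite Es, E1 by assumption. }
  assert (HN : forall r : nat -> R -> R,
            (forall n v, V v -> is_derive (r n) v (r (S n) v)) -> forall v, V v ->
            is_derive (fun v => w v * r 1%nat v) v
                      (w v * r 2%nat v - 1/3 * D1 v * w v ^ 4 * r 1%nat v)).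
  { intros r Hr v Hv. assert (A1 := Hr 1%nat v Hv). assert (A2 := Hw v Hv).
    auto_derive.
    - repeat split; eexists; eassumption.
    - rewrite_derive A1; rewrite_derive A2. field. }
  assert (HN' : forall v, V v -> Nor c v =
            (w v * (w v * p 2%nat v - 1/3 * D1 v * w v ^ 4 * p 1%nat v),
             w v * (w v * q 2%nat v - 1/3 * D1 v * w v ^ 4 * q 1%nat v))).
  { intros v Hv. unfold Nor. rewrite Es by assumption. unfold vscal, dv; cbn [fst snd]. f_equal; f_equal.
    - eapply loc; [exact Hv | intros u Hu; rewrite (HT u Hu); reflexivity | now apply HN].
    - eapply loc; [exact Hv | intros u Hu; rewrite (HT u Hu); reflexivity | now apply HN]. }
  assert (HNd : forall r : nat -> R -> R,
            (forall n v, V v -> is_derive (r n) v (r (S n) v)) -> forall v, V v ->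
            is_derive (fun v => w v * (w v * r 2%nat v - 1/3 * D1 v * w v ^ 4 * r 1%nat v)) v
              (w v ^ 2 * r 3%nat v - D1 v * w v ^ 5 * r 2%nat v
               - 1/3 * D2 v * w v ^ 5 * r 1%nat v + 5/9 * D1 v ^ 2 * w v ^ 8 * r 1%nat v)).
  { intros r Hr v Hv. assert (A1 := Hr 1%nat v Hv). assert (A2 := Hr 2%nat v Hv).
    assert (A3 := Hw v Hv). assert (A4 := HD2 v Hv).
    auto_derive.
    - repeat split; eexists; eassumption.
    - rewrite_derive A1; rewrite_derive A2; rewrite_derive A3; rewrite_derive A4. simpl. field. }
  intros v Hv.
  assert (E3 : dv (Nor c) v =
     (w v ^ 2 * p 3%nat v - D1 v * w v ^ 5 * p 2%nat v
        - 1/3 * D2 v * w v ^ 5 * p 1%nat v + 5/9 * D1 v ^ 2 * w v ^ 8 * p 1%nat v,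
      w v ^ 2 * q 3%nat v - D1 v * w v ^ 5 * q 2%nat v
        - 1/3 * D2 v * w v ^ 5 * q 1%nat v + 5/9 * D1 v ^ 2 * w v ^ 8 * q 1%nat v)).
  { unfold dv. f_equal.
    - eapply loc; [exact Hv | intros u Hu; rewrite (HN' u Hu); reflexivity | now apply HNd].
    - eapply loc; [exact Hv | intros u Hu; rewrite (HN' u Hu); reflexivity | now apply HNd]. }
  rewrite E3, HN' by assumption. unfold density.
  change (p 1%nat v * q 2%nat v - q 1%nat v * p 2%nat v) with (D v).
  rewrite W4, W7. assert (X := WD v Hv). unfold det; simpl.
  (* Bilinear expansion of |N, N_u|. The terms containing |c_1, c_2| keep D w^3 as a separate
     factor, to be replaced by 1. *)
  transitivity (w v ^ 4 * (p 2%nat v * q 3%nat v - q 2%nat v * p 3%nat v)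
     + (1/3 * D2 v * w v ^ 4 - 5/9 * D1 v ^ 2 * w v ^ 7) * (D v * w v ^ 3)
     - 1/3 * D1 v * w v ^ 7 * D1 v + 1/3 * D1 v ^ 2 * w v ^ 7 * (D v * w v ^ 3)).
  - unfold D, D1. field.
  - rewrite X. unfold D1, D2. field.
Qed.

(** * First variation *)

Lemma smooth2_C1t_dsn U F n :
  open2 U -> smooth2 U F -> C1t U (dsn n F) (dsn n (pd true F)).
Proof.
  intros HU H t s Hts.
  destruct (smooth2_C1t U _ (smooth2_dsn U F n H) t s Hts) as (A & B & _).
  rewrite (dsn_pd_true U) in B by assumption.
  split; [exact A | split; [exact B |]].
  apply (smooth2_continuous U); [| exact Hts]. now apply smooth2_dsn, smooth2_pd.
Qed.

Lemma Dn_slice a b (gamma : R -> R2) (Gam : R -> R -> R2) n s :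
  (forall s, inI a b s -> Gam 0 s = gamma s) -> inI a b s ->
  Dn n gamma s = (dsn n (fun t s => fst (Gam t s)) 0 s, dsn n (fun t s => snd (Gam t s)) 0 s).
Proof.
  intros H Hs. unfold Dn. rewrite !dsn_Derive_n.
  f_equal; apply Derive_n_ext_loc; (eapply filter_imp; [| exact (inI_open _ _ _ Hs)]);
    intros u Hu; simpl; now rewrite H.
Qed.

Lemma dsn_pd_true_zero (J : R -> Prop) F e n :
  0 < e -> (forall s, J s -> locally s J) ->
  (forall t s, - e < t < e -> J s -> F t s = F 0 s) ->
  forall s, J s -> dsn n (pd true F) 0 s = 0.
Proof.
  intros He HJ HF. induction n as [| n IH]; intros s Hs.
  - change (Derive (fun t => F t s) 0 = 0).
    rewrite (Derive_ext_loc _ (fun _ => F 0 s)); [apply Derive_const |].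
    apply (filter_imp (fun t => - e < t /\ t < e)).
    + intros t Ht. now apply HF.
    + apply filter_and; [apply open_gt | apply open_lt]; lra.
  - change (Derive (dsn n (pd true F) 0) s = 0).
    rewrite (Derive_ext_loc _ (fun _ => 0)); [apply Derive_const |].
    eapply filter_imp; [| exact (HJ s Hs)]. exact IH.
Qed.

(** Performs all integrations by parts at once: [B] gathers the boundary terms, so that only one
    derivative has to be checked. *)
Lemma RInt_modulo_exact (f m B : R -> R) (r x y : R) :
  x <= y ->
  (forall s, x <= s <= y -> continuous f s) ->
  (forall s, x <= s <= y -> continuous m s) ->
  (forall s, x <= s <= y -> is_derive B s (f s - r * m s)) ->
  B x = 0 -> B y = 0 -> RInt f x y = r * RInt m x y.
Proof.
  intros Hxy Hf Hm HB Bx By.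
  assert (Im : is_RInt m x y (RInt m x y)).
  { apply (@RInt_correct R_CompleteNormedModule), (@ex_RInt_continuous R_CompleteNormedModule).
    rewrite Rmin_left, Rmax_right by lra. exact Hm. }
  assert (IB : is_RInt (fun s => f s - r * m s) x y (minus (B y) (B x))).
  { apply (is_RInt_derive B (fun s => f s - r * m s));
      rewrite Rmin_left, Rmax_right by lra; [exact HB |].
    intros s Hs. apply (continuous_minus f (fun s => r * m s)); [now apply Hf |].
    apply (continuous_scal_r (r : R_AbsRing) m). now apply Hm. }
  apply is_RInt_unique.
  replace (r * RInt m x y) with (plus (minus (B y) (B x)) (scal r (RInt m x y))).
  2: { rewrite Bx, By. unfold minus, plus, opp, scal; simpl. unfold mult; simpl. ring. }
  apply (is_RInt_ext (fun s => plus (f s - r * m s) (scal r (m s)))).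
  - intros s _. unfold plus, scal; simpl. unfold mult; simpl. ring.
  - apply (is_RInt_plus (fun s => f s - r * m s) (fun s => scal r (m s))); [exact IB |].
    now apply (is_RInt_scal m).
Qed.

Lemma Rpower_1_base r : Rpower 1 r = 1.
Proof. unfold Rpower. rewrite ln_1, Rmult_0_r. apply exp_0. Qed.

Definition vfield (Gam : R -> R -> R2) (s : R) : R2 :=
  (Derive (fun t => fst (Gam t s)) 0, Derive (fun t => snd (Gam t s)) 0).

Definition curv_deriv (a b : Rbar) (kappa k1 k2 : R -> R) : Prop :=
  forall s, inI a b s ->
    is_derive kappa s (k1 s) /\ is_derive k1 s (k2 s) /\ continuous k2 s.

(** Both integrals are differentiated under the integral sign on a strip where D > 0, and the result
    is reduced modulo an exact derivative to a multiple of |V, T|. The integrability clause allows a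
    constant factor to be taken out of the integral later. *)
Lemma first_variation a b gamma kappa k1 k2 eps Gam x y :
  (forall s, inI a b s -> det (Dn 1 gamma s) (Dn 2 gamma s) = 1) ->
  (forall s, inI a b s -> Dn 3 gamma s = vscal (- kappa s) (Dn 1 gamma s)) ->
  curv_deriv a b kappa k1 k2 ->
  is_variation a b gamma eps Gam x y ->
  ex_RInt (fun s => det (vfield Gam s) (Dn 1 gamma s)) x y /\
  delta_TotCurv Gam x y =
    - (2/3) * RInt (fun s => (k2 s + kappa s ^ 2) * det (vfield Gam s) (Dn 1 gamma s)) x y /\
  delta_Area Gam x y = RInt (fun s => det (vfield Gam s) (Dn 1 gamma s)) x y.
Proof.
  intros H12 H3 Hk (He & Hax & Hxy & Hyb & SF & SG & H0 & Hout).
  set (F := fun t s => fst (Gam t s)) in *. set (G := fun t s => snd (Gam t s)) in *.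
  set (U := dom a b eps). change (smooth2 U F) in SF. change (smooth2 U G) in SG.
  assert (HU : open2 U) by apply dom_open.
  assert (HI : forall s, x <= s <= y -> inI a b s).
  { intros s Hs. split.
    - apply Rbar_lt_le_trans with x; [exact Hax | apply Hs].
    - apply Rbar_le_lt_trans with y; [apply Hs | exact Hyb]. }
  assert (U0 : forall s, inI a b s -> U 0 s) by (intros s Hs; split; [lra | exact Hs]).
  assert (CP : forall n, C1t U (dsn n F) (dsn n (pd true F)))
    by (intros; now apply smooth2_C1t_dsn).
  assert (CQ : forall n, C1t U (dsn n G) (dsn n (pd true G)))
    by (intros; now apply smooth2_C1t_dsn).
  set (p := fun n s => dsn n F 0 s). set (q := fun n s => dsn n G 0 s).
  set (v := fun n s => dsn n (pd true F) 0 s). set (w := fun n s => dsn n (pd true G) 0 s).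
  assert (dp : forall n s, inI a b s -> is_derive (p n) s (p (S n) s))
    by (intros; apply (dsn_is_derive U); auto).
  assert (dq : forall n s, inI a b s -> is_derive (q n) s (q (S n) s))
    by (intros; apply (dsn_is_derive U); auto).
  assert (dv : forall n s, inI a b s -> is_derive (v n) s (v (S n) s))
    by (intros; apply (dsn_is_derive U); auto using smooth2_pd).
  assert (dw : forall n s, inI a b s -> is_derive (w n) s (w (S n) s))
    by (intros; apply (dsn_is_derive U); auto using smooth2_pd).
  assert (EDn : forall n s, inI a b s -> Dn n gamma s = (p n s, q n s))
    by (intros; now apply (Dn_slice a b)).
  assert (e12 : forall s, inI a b s -> p 1%nat s * q 2%nat s - q 1%nat s * p 2%nat s = 1).
  { intros s Hs. specialize (H12 s Hs). rewrite !EDn in H12 by assumption. exact H12. }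
  assert (e3 : forall s, inI a b s ->
            p 3%nat s = - kappa s * p 1%nat s /\ q 3%nat s = - kappa s * q 1%nat s).
  { intros s Hs. specialize (H3 s Hs). rewrite !EDn in H3 by assumption.
    injection H3; auto. }
  assert (e4 : forall r : nat -> R -> R,
            (forall n s, inI a b s -> is_derive (r n) s (r (S n) s)) ->
            (forall s, inI a b s -> r 3%nat s = - kappa s * r 1%nat s) ->
            forall s, inI a b s -> r 4%nat s = - k1 s * r 1%nat s - kappa s * r 2%nat s).
  { intros r Hr Hr3 s Hs. assert (A1 := Hr 1%nat s Hs). destruct (Hk s Hs) as (A2 & _).
    rewrite <- (is_derive_unique _ _ _ (Hr 3%nat s Hs)).
    apply is_derive_unique.
    apply is_derive_ext_loc with (fun s => - kappa s * r 1%nat s).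
    - eapply filter_imp; [| exact (inI_open _ _ _ Hs)]. intros u Hu. symmetry. now apply Hr3.
    - auto_derive; [repeat split; eexists; eassumption |].
      rewrite_derive A1; rewrite_derive A2. ring. }
  assert (ep4 := e4 p dp (fun s Hs => proj1 (e3 s Hs))).
  assert (eq4 := e4 q dq (fun s Hs => proj2 (e3 s Hs))).
  (* The variation field vanishes outside [x, y], so by continuity all its
     derivatives vanish at the endpoints. *)
  assert (v0 : forall z n, z = x \/ z = y -> v n z = 0 /\ w n z = 0).
  { intros z n Hz.
    assert (HJ : forall J : R -> Prop,
              (forall s, J s -> locally s J) ->
              (forall s, J s -> inI a b s /\ (s < x \/ y < s)) ->
              forall s, J s -> v n s = 0 /\ w n s = 0).
    { intros J OJ IJ s Hs.
      split; apply (dsn_pd_true_zero J _ eps n He OJ); try exact Hs;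
        intros t u Ht Hu; destruct (IJ u Hu) as [Iu Ou]; unfold F, G;
        rewrite (Hout t u Ht Iu Ou), (H0 u Iu); reflexivity. }
    assert (Iz : inI a b z) by (apply HI; lra).
    assert (adh : forall e : posreal, exists u : R, ball z e u /\ v n u = 0 /\ w n u = 0).
    { intros e. destruct (inI_open _ _ _ Iz) as [e' He'].
      set (d := Rmin e e' / 2).
      assert (0 < d /\ d < e /\ d < e') as (Hd & Hde & Hde').
      { assert (A1 := cond_pos e). assert (A2 := cond_pos e').
        assert (A3 := Rmin_pos _ _ A1 A2). assert (A4 := Rmin_l e e').
        assert (A5 := Rmin_r e e'). unfold d; lra. }
      assert (bl : forall u r, Rabs (u - z) < r -> ball z r u) by (intros; assumption).
      destruct Hz as [-> | ->].
      - exists (x - d). split; [apply bl; rewrite Rabs_left; lra |].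
        apply (HJ (fun s => inI a b s /\ s < x)).
        + intros s [S1 S2]. apply filter_and; [now apply inI_open | now apply open_lt].
        + intros s [S1 S2]. auto.
        + split; [| lra]. apply He', bl. rewrite Rabs_left; lra.
      - exists (y + d). split; [apply bl; rewrite Rabs_right; lra |].
        apply (HJ (fun s => inI a b s /\ y < s)).
        + intros s [S1 S2]. apply filter_and; [now apply inI_open | now apply open_gt].
        + intros s [S1 S2]. auto.
        + split; [| lra]. apply He', bl. rewrite Rabs_right; lra. }
    assert (cv : continuous (v n) z)
      by (apply (ex_derive_continuous (v n)); exists (v (S n) z); apply dv, Iz).
    assert (cw : continuous (w n) z)
      by (apply (ex_derive_continuous (w n)); exists (w (S n) z); apply dw, Iz).
    split.
    - apply (continuous_zero_adherent (v n) z cv).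
      intros e; destruct (adh e) as (u & Bu & Vu & Wu); exists u; auto.
    - apply (continuous_zero_adherent (w n) z cw).
      intros e; destruct (adh e) as (u & Bu & Vu & Wu); exists u; auto. }
  set (D := fun t s => dsn 1 F t s * dsn 2 G t s - dsn 1 G t s * dsn 2 F t s).
  assert (CD : exists dD, C1t U D dD).
  { eexists. apply C1t_minus; apply C1t_mult; auto. }
  destruct CD as [dD CD].
  set (U' := fun t s => U t s /\ 0 < D t s).
  assert (HU' : open2 U').
  { intros t s [Hts HD]. apply filter_and; [now apply HU |].
    destruct (CD t s Hts) as (A & _). apply (A (fun z => 0 < z)). now apply open_gt. }
  (* Tube argument: D(0, s) = 1 on the compact [x, y], so uniform continuity with tolerance 1/2
     keeps D above 1/2 for all small t, simultaneously in s. *)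
  assert (Hd : exists d, 0 < d /\ forall t s, - d < t < d -> x <= s <= y -> U' t s).
  { destruct (uniform_continuity_2d_1d' D x y 0) with (eps := mkposreal (/2) ltac:(lra))
      as [d Hd].
    { intros s Hs. apply continuity_2d_pt_filterlim. apply (CD 0 s), U0, HI, Hs. }
    exists (Rmin d eps). split; [apply Rmin_pos; [apply d | exact He] |].
    intros t s Ht Hs. assert (L1 := Rmin_l d eps). assert (L2 := Rmin_r d eps).
    split; [split; [lra | now apply HI] |].
    specialize (Hd s 0 s t Hs).
    assert (E1 : D 0 s = 1) by (apply e12, HI, Hs).
    rewrite E1 in Hd. simpl in Hd.
    assert (Rabs (D t s - 1) < / 2).
    { apply Hd; try lra. rewrite Rminus_diag, Rabs_R0. apply d. }
    apply Rabs_def2 in H. lra. }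
  destruct Hd as (d & Hd & HdU).
  assert (Ld : locally 0 (fun t => - d < t < d)).
  { apply (filter_and (F := locally 0) (fun t => - d < t) (fun t => t < d));
      [apply open_gt | apply open_lt]; lra. }
  assert (CP' : forall n, C1t U' (dsn n F) (dsn n (pd true F)))
    by (intros n; apply (C1t_sub U); [now intros t s [] | apply CP]).
  assert (CQ' : forall n, C1t U' (dsn n G) (dsn n (pd true G)))
    by (intros n; apply (C1t_sub U); [now intros t s [] | apply CQ]).
  assert (Em : forall s, inI a b s ->
            det (vfield Gam s) (Dn 1 gamma s) = v O s * q 1%nat s - w O s * p 1%nat s).
  { intros s Hs. rewrite EDn by exact Hs. reflexivity. }
  assert (cont : forall (f : R -> R) (l s : R), is_derive f s l -> continuous f s).
  { intros f l s Hf. apply (ex_derive_continuous f). now exists l. }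
  assert (Cm : forall s, inI a b s ->
            continuous (fun s => v O s * q 1%nat s - w O s * p 1%nat s) s).
  { intros s Hs.
    apply (continuous_minus (fun s => v O s * q 1%nat s) (fun s => w O s * p 1%nat s)).
    - apply (continuous_mult (v O) (q 1%nat)); eapply cont; [apply dv | apply dq]; exact Hs.
    - apply (continuous_mult (w O) (p 1%nat)); eapply cont; [apply dw | apply dp]; exact Hs. }
  split; [| split].
  - apply (ex_RInt_ext (fun s => v O s * q 1%nat s - w O s * p 1%nat s)).
    + rewrite Rmin_left, Rmax_right by lra. intros s Hs. symmetry. apply Em, HI; lra.
    + apply (@ex_RInt_continuous R_CompleteNormedModule).
      rewrite Rmin_left, Rmax_right by lra. intros s Hs. apply Cm, HI, Hs.
  - set (K := fun t s =>
      density (dsn 1 F t s) (dsn 2 F t s) (dsn 3 F t s) (dsn 4 F t s)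
              (dsn 1 G t s) (dsn 2 G t s) (dsn 3 G t s) (dsn 4 G t s)).
    (* The general derivative is left to unification; only its value at t = 0 is simplified, where
       the base curve has D = 1 and |c_1, c_3| = 0. *)
    assert (CK : exists dK, C1t U' K dK /\ forall s, inI a b s -> dK 0 s =
        - 4/3 * kappa s * ((v 1%nat s * q 2%nat s - w 1%nat s * p 2%nat s)
                           + (p 1%nat s * w 2%nat s - q 1%nat s * v 2%nat s))
        + 4/3 * ((v 2%nat s * q 3%nat s - w 2%nat s * p 3%nat s)
                 + (p 2%nat s * w 3%nat s - q 2%nat s * v 3%nat s))
        + 1/3 * ((v 1%nat s * q 4%nat s - w 1%nat s * p 4%nat s)
                 + (p 1%nat s * w 4%nat s - q 1%nat s * v 4%nat s))).
    { eexists. split.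
      - unfold K, density.
        apply C1t_minus; [apply C1t_mult |
          apply C1t_scal, C1t_mult; [| apply C1t_mult; apply C1t_minus; apply C1t_mult; auto]].
        + apply C1t_Rpower; [now intros t s [_ HD] |].
          apply C1t_minus; apply C1t_mult; auto.
        + apply C1t_plus; apply C1t_scal, C1t_minus; apply C1t_mult; auto.
        + apply C1t_Rpower; [now intros t s [_ HD] |].
          apply C1t_minus; apply C1t_mult; auto.
      - intros s Hs. cbv beta.
        change (dsn 1 F 0 s) with (p 1%nat s). change (dsn 2 F 0 s) with (p 2%nat s).
        change (dsn 3 F 0 s) with (p 3%nat s). change (dsn 4 F 0 s) with (p 4%nat s).
        change (dsn 1 G 0 s) with (q 1%nat s). change (dsn 2 G 0 s) with (q 2%nat s).
        change (dsn 3 G 0 s) with (q 3%nat s). change (dsn 4 G 0 s) with (q 4%nat s).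
        change (dsn 1 (pd true F) 0 s) with (v 1%nat s).
        change (dsn 2 (pd true F) 0 s) with (v 2%nat s).
        change (dsn 3 (pd true F) 0 s) with (v 3%nat s).
        change (dsn 4 (pd true F) 0 s) with (v 4%nat s).
        change (dsn 1 (pd true G) 0 s) with (w 1%nat s).
        change (dsn 2 (pd true G) 0 s) with (w 2%nat s).
        change (dsn 3 (pd true G) 0 s) with (w 3%nat s).
        change (dsn 4 (pd true G) 0 s) with (w 4%nat s).
        (* All powers of D become 1. The term in D^(-7/3) drops out, since it contains the square of
           |c_1, c_3| = 0. Differentiating D^(-4/3) gives -4/3 times the derivative of D times the
           bracket, whose value is 4/3 kappa - 1/3 kappa = kappa. *)
        rewrite (e12 s Hs), !Rpower_1_base.
        assert (X1 : p 1%nat s * q 3%nat s - q 1%nat s * p 3%nat s = 0).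
        { destruct (e3 s Hs) as [-> ->]. ring. }
        assert (X2 : p 2%nat s * q 3%nat s - q 2%nat s * p 3%nat s = kappa s).
        { destruct (e3 s Hs) as [-> ->].
          transitivity (kappa s * (p 1%nat s * q 2%nat s - q 1%nat s * p 2%nat s));
            [ring | rewrite e12 by exact Hs; ring]. }
        assert (X3 : p 1%nat s * q 4%nat s - q 1%nat s * p 4%nat s = - kappa s).
        { rewrite ep4, eq4 by exact Hs.
          transitivity (- kappa s * (p 1%nat s * q 2%nat s - q 1%nat s * p 2%nat s));
            [ring | rewrite e12 by exact Hs; ring]. }
        rewrite X1, X2, X3. field. }
    destruct CK as (dK & CK & EK).
    transitivity (RInt (dK 0) x y).
    { apply is_derive_unique.
      apply is_derive_ext_loc with (fun t => RInt (K t) x y).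
      - eapply filter_imp; [| exact Ld]. intros t Ht. unfold TotCurv.
        apply RInt_ext. rewrite Rmin_left, Rmax_right by lra. intros s Hs.
        symmetry.
        apply (density_correct (U' t) (Gam t) (fun n => dsn n F t) (fun n => dsn n G t)).
        + intros z Hz. now apply (open2_snd U').
        + reflexivity.
        + reflexivity.
        + intros n z [Hz _]. now apply (dsn_is_derive U).
        + intros n z [Hz _]. now apply (dsn_is_derive U).
        + now intros z [_ Hz].
        + apply HdU; lra.
      - now apply (is_derive_RInt_C1t U' K dK x y d). }
    rewrite (RInt_ext (fun s => (k2 s + kappa s ^ 2) * det (vfield Gam s) (Dn 1 gamma s))
               (fun s => (k2 s + kappa s ^ 2) * (v O s * q 1%nat s - w O s * p 1%nat s))).
    2: { rewrite Rmin_left, Rmax_right by lra. intros s Hs. rewrite Em; [reflexivity |].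
         apply HI; lra. }
    (* The boundary terms of integrating [dK 0] by parts until no derivative
       falls on the variation field. *)
    set (B := fun s =>
      1/3 * (p 1%nat s * w 3%nat s - q 1%nat s * v 3%nat s)
      + (p 2%nat s * w 2%nat s - q 2%nat s * v 2%nat s)
      - kappa s * (v 1%nat s * q 1%nat s - w 1%nat s * p 1%nat s)
      + 2/3 * k1 s * (v O s * q 1%nat s - w O s * p 1%nat s)
      - 2/3 * kappa s * (v O s * q 2%nat s - w O s * p 2%nat s)).
    apply (RInt_modulo_exact _ _ B); [exact Hxy | | | | |].
    + intros s Hs. apply continuous_slice, CK, HdU; lra.
    + intros s Hs. assert (Is := HI s Hs). destruct (Hk s Is) as (A1 & A2 & A3).
      apply (continuous_mult (fun s => k2 s + kappa s ^ 2)); [| now apply Cm].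
      apply (continuous_plus k2 (fun s => kappa s ^ 2)); [exact A3 |].
      apply (continuous_comp kappa (fun z => z ^ 2)); [now apply (cont _ (k1 s)) |].
      apply (ex_derive_continuous (fun z : R => z ^ 2)). auto_derive; auto.
    + intros s Hs. assert (Is := HI s Hs). destruct (Hk s Is) as (A1 & A2 & _).
      rewrite EK by exact Is. unfold B.
      assert (P1 := dp 1%nat s Is). assert (P2 := dp 2%nat s Is).
      assert (Q1 := dq 1%nat s Is). assert (Q2 := dq 2%nat s Is).
      assert (V0 := dv 0%nat s Is). assert (V1 := dv 1%nat s Is).
      assert (V2 := dv 2%nat s Is). assert (V3 := dv 3%nat s Is).
      assert (W0 := dw 0%nat s Is). assert (W1 := dw 1%nat s Is).
      assert (W2 := dw 2%nat s Is). assert (W3 := dw 3%nat s Is).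
      clearbody p q v w.
      auto_derive; [repeat split; eexists; eassumption |].
      rewrite_derive P1; rewrite_derive P2; rewrite_derive Q1; rewrite_derive Q2.
      rewrite_derive V0; rewrite_derive V1; rewrite_derive V2; rewrite_derive V3.
      rewrite_derive W0; rewrite_derive W1; rewrite_derive W2; rewrite_derive W3.
      rewrite_derive A1; rewrite_derive A2.
      rewrite ep4, eq4 by exact Is. destruct (e3 s Is) as [-> ->]. field.
    + unfold B. destruct (v0 x 0%nat) as [-> ->]; [auto |].
      destruct (v0 x 1%nat) as [-> ->]; [auto |]. destruct (v0 x 2%nat) as [-> ->]; [auto |].
      destruct (v0 x 3%nat) as [-> ->]; [auto |]. ring.
    + unfold B. destruct (v0 y 0%nat) as [-> ->]; [auto |].
      destruct (v0 y 1%nat) as [-> ->]; [auto |]. destruct (v0 y 2%nat) as [-> ->]; [auto |].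
      destruct (v0 y 3%nat) as [-> ->]; [auto |]. ring.
  - set (K := fun t s => / 2 * (dsn 0 F t s * dsn 1 G t s - dsn 0 G t s * dsn 1 F t s)).
    assert (CK : exists dK, C1t U' K dK /\ forall s, inI a b s -> dK 0 s =
        / 2 * ((v O s * q 1%nat s + p O s * w 1%nat s)
               - (w O s * p 1%nat s + q O s * v 1%nat s))).
    { eexists. split.
      - apply C1t_scal, C1t_minus; apply C1t_mult; auto.
      - intros s Hs. reflexivity. }
    destruct CK as (dK & CK & EK).
    transitivity (RInt (dK 0) x y).
    { apply is_derive_unique. now apply (is_derive_RInt_C1t U' K dK x y d). }
    rewrite (RInt_ext (fun s => det (vfield Gam s) (Dn 1 gamma s))
               (fun s => v O s * q 1%nat s - w O s * p 1%nat s)).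
    2: { rewrite Rmin_left, Rmax_right by lra. intros s Hs. apply Em, HI; lra. }
    (* The linearised integrand is 1/2 (|V, T| + |gamma, V'|), which differs from |V, T| by the
       derivative of 1/2 |gamma, V|. *)
    set (B := fun s => / 2 * (p O s * w O s - q O s * v O s)).
    etransitivity; [| apply Rmult_1_l].
    apply (RInt_modulo_exact _ _ B); [exact Hxy | | | | |].
    + intros s Hs. apply continuous_slice, CK, HdU; lra.
    + intros s Hs. apply Cm, HI, Hs.
    + intros s Hs. assert (Is := HI s Hs). rewrite EK by exact Is. unfold B.
      assert (P0 := dp 0%nat s Is). assert (Q0 := dq 0%nat s Is).
      assert (V0 := dv 0%nat s Is). assert (W0 := dw 0%nat s Is).
      auto_derive; [repeat split; eexists; eassumption |].
      rewrite_derive P0; rewrite_derive Q0; rewrite_derive V0; rewrite_derive W0. field.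
    + unfold B. destruct (v0 x 0%nat) as [-> ->]; [auto |]. ring.
    + unfold B. destruct (v0 y 0%nat) as [-> ->]; [auto |]. ring.
Qed.

(** * Bump functions *)

(** Differentiability of order n through a chain of witnesses, each constrained only on [U]. Closure
    under products then follows by induction, without Leibniz's formula. Order 0 asks nothing, not
    even continuity. *)
Fixpoint Cn (U : R -> Prop) (n : nat) (f : R -> R) : Prop :=
  match n with
  | O => True
  | S n => exists f', (forall s, U s -> is_derive f s (f' s)) /\ Cn U n f'
  end.

Definition Cinf U f := forall n, Cn U n f.

Lemma Cn_S U n f : Cn U (S n) f -> Cn U n f.
Proof.
  revert f; induction n as [| n IH]; intros f; [easy |].
  intros (f' & H1 & H2). exists f'. split; [exact H1 | now apply IH].
Qed.

Lemma Cn_plus U n f g : Cn U n f -> Cn U n g -> Cn U n (fun s => f s + g s).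
Proof.
  revert f g; induction n as [| n IH]; intros f g; [easy |].
  intros (f' & H1 & H2) (g' & H3 & H4). exists (fun s => f' s + g' s). split.
  - intros s Hs. apply (is_derive_plus f g); auto.
  - now apply IH.
Qed.

Lemma Cn_mult U n f g : Cn U n f -> Cn U n g -> Cn U n (fun s => f s * g s).
Proof.
  revert f g; induction n as [| n IH]; intros f g; [easy |].
  intros Hf Hg. assert (Hf0 := Cn_S _ _ _ Hf). assert (Hg0 := Cn_S _ _ _ Hg).
  destruct Hf as (f' & H1 & H2), Hg as (g' & H3 & H4).
  exists (fun s => f' s * g s + f s * g' s). split.
  - intros s Hs. apply (is_derive_mult f g); auto. intros; apply Rmult_comm.
  - apply Cn_plus; now apply IH.
Qed.

Lemma Cn_const U n k : Cn U n (fun _ => k).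
Proof.
  revert k; induction n as [| n IH]; intros k; [easy |].
  exists (fun _ => 0). split; [| apply IH]. intros s _. apply (is_derive_const (K := R_AbsRing) (V := R_NormedModule) k s).
Qed.

Lemma Cn_comp_affine n f k c :
  Cn (fun _ => True) n f -> Cn (fun _ => True) n (fun s => f (k * s + c)).
Proof.
  revert f; induction n as [| n IH]; intros f; [easy |].
  intros (f' & H1 & H2). exists (fun s => k * f' (k * s + c)). split.
  - intros s _. apply (is_derive_comp f (fun s => k * s + c)); [now apply H1 |].
    auto_derive; [easy | ring].
  - apply (Cn_mult _ _ (fun _ => k)); [apply Cn_const | now apply IH].
Qed.

Lemma Cn_sub (U V : R -> Prop) n f : (forall s, V s -> U s) -> Cn U n f -> Cn V n f.
Proof.
  intros HUV. revert f; induction n as [| n IH]; intros f; [easy |].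
  intros (f' & H1 & H2). exists f'. split; auto.
Qed.

Lemma Cn_ext (U : R -> Prop) n f g :
  (forall s, U s -> locally s U) -> (forall s, U s -> f s = g s) -> Cn U n f -> Cn U n g.
Proof.
  intros OU E. destruct n as [| n]; [easy |].
  intros (f' & H1 & H2). exists f'. split; [| exact H2].
  intros s Hs. apply is_derive_ext_loc with f; [| now apply H1].
  eapply filter_imp; [| exact (OU s Hs)]. exact E.
Qed.

(** [Cinf] may supply a different witness f' for each order; uniqueness of derivatives identifies
    all of them with [Derive f] on [U]. *)
Lemma Cinf_Derive (U : R -> Prop) f :
  (forall s, U s -> locally s U) -> Cinf U f ->
  (forall s, U s -> is_derive f s (Derive f s)) /\ Cinf U (Derive f).
Proof.
  intros OU H. split.
  - intros s Hs. destruct (H 1%nat) as (f' & H1 & _). apply Derive_correct.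
    eexists; now apply H1.
  - intros n. destruct (H (S n)) as (f' & H1 & H2).
    apply (Cn_ext U n f'); [exact OU | | exact H2].
    intros s Hs. symmetry. apply is_derive_unique. now apply H1.
Qed.

Lemma Cinf_Derive_n (U : R -> Prop) f :
  (forall (n : nat) s, U s -> ex_derive_n f n s) -> forall k, Cinf U (Derive_n f k).
Proof.
  intros H k n. revert k. induction n as [| n IH]; intros k; [easy |].
  exists (Derive_n f (S k)). split; [| apply IH].
  intros s Hs. apply Derive_correct. exact (H (S k) s Hs).
Qed.

(** The classical exp(-1/x), extended by 0, with a factor x^(-k): the factor makes the family stable
    under differentiation up to linear combinations, so smoothness of all members is proved by one
    induction. *)
Definition flat (k : nat) (x : R) : R :=
  if Rle_dec x 0 then 0 else (/ x) ^ k * exp (- / x).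

Lemma flat_neg k x : x <= 0 -> flat k x = 0.
Proof. intros H. unfold flat. now destruct (Rle_dec x 0). Qed.

Lemma flat_pos k x : 0 < x -> flat k x = (/ x) ^ k * exp (- / x).
Proof. intros H. unfold flat. destruct (Rle_dec x 0); [lra | reflexivity]. Qed.

Lemma flat_gt0 k x : 0 < x -> 0 < flat k x.
Proof.
  intros H. rewrite flat_pos by exact H. apply Rmult_lt_0_compat.
  - apply pow_lt. now apply Rinv_0_lt_compat.
  - apply exp_pos.
Qed.

(** For u = 1/x > 0 the Taylor bound exp u >= u^(k+1) / (k+1)! gives u^k exp(-u) <= (k+1)! / u. A
    bound linear in x is what the derivative at 0 needs. *)
Lemma flat_bound k : exists M, 0 <= M /\ forall x, Rabs (flat k x) <= M * Rabs x.
Proof.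
  exists (INR (Factorial.fact (S k))). split; [apply pos_INR |]. intros x.
  destruct (Rle_lt_dec x 0) as [H | H].
  - rewrite flat_neg, Rabs_R0 by exact H. apply Rmult_le_pos; [apply pos_INR | apply Rabs_pos].
  - rewrite (Rabs_right (flat k x)) by (apply Rle_ge, Rlt_le, flat_gt0, H).
    rewrite (Rabs_right x), flat_pos by lra.
    set (u := / x). assert (Hu : 0 < u) by (now apply Rinv_0_lt_compat).
    assert (Hf : 0 < INR (Factorial.fact (S k))) by (apply INR_fact_lt_0).
    assert (T : u ^ S k / INR (Factorial.fact (S k)) <= exp u).
    { eapply Rle_trans; [| apply (exp_ge_taylor u (S k)); lra].
      cbn [sum_f_R0].
      assert (0 <= sum_f_R0 (fun i => u ^ i / INR (Factorial.fact i)) k); [| lra].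
      apply cond_pos_sum. intros i. apply Rlt_le, Rdiv_lt_0_compat;
        [now apply pow_lt | apply INR_fact_lt_0]. }
    replace x with (/ u) by (unfold u; field; lra).
    rewrite exp_Ropp. assert (He := exp_pos u).
    apply Rmult_le_reg_r with (u * exp u); [now apply Rmult_lt_0_compat |].
    replace (u ^ k * / exp u * (u * exp u)) with (u ^ S k) by (simpl; field; lra).
    replace (INR (Factorial.fact (S k)) * / u * (u * exp u))
      with (exp u * INR (Factorial.fact (S k))) by (field; lra).
    apply Rle_div_l in T; lra.
Qed.

Lemma flat_derive k x :
  is_derive (flat k) x (flat (S (S k)) x - INR k * flat (S k) x).
Proof.
  destruct (Rtotal_order x 0) as [H | [-> | H]].
  - rewrite !flat_neg, Rmult_0_r, Rminus_0_r by lra.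
    apply is_derive_ext_loc with (fun _ => 0); [| apply (is_derive_const 0)].
    apply (filter_imp (fun z => z < 0)); [| now apply open_lt].
    intros z Hz. rewrite flat_neg; lra.
  - rewrite !flat_neg, Rmult_0_r, Rminus_0_r by lra.
    destruct (flat_bound (S k)) as (M & HM & HB).
    apply is_derive_Reals. intros e He.
    assert (Hd : 0 < e / (M + 1)) by (apply Rdiv_lt_0_compat; lra).
    exists (mkposreal _ Hd). intros h Hh Hl. simpl in Hl.
    rewrite Rplus_0_l, (flat_neg k 0), !Rminus_0_r by lra.
    (* Dividing by h raises the index by one, so the difference quotient at 0 is again a member of
       the family and tends to 0. *)
    assert (E : flat k h / h = flat (S k) h).
    { destruct (Rle_lt_dec h 0) as [L | L].
      - rewrite !flat_neg by exact L. field. exact Hh.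
      - rewrite !flat_pos by exact L. simpl. field. exact Hh. }
    rewrite E. eapply Rle_lt_trans; [apply HB |].
    assert (Rabs h * (M + 1) < e) by (apply Rlt_div_r in Hl; lra).
    assert (0 < Rabs h) by (now apply Rabs_pos_lt). lra.
  - rewrite !flat_pos by exact H.
    apply is_derive_ext_loc with (fun x => (/ x) ^ k * exp (- / x)).
    + apply (filter_imp (fun z => 0 < z)); [| now apply open_gt].
      intros z Hz. now rewrite flat_pos.
    + auto_derive; [lra |]. destruct k as [| k]; [simpl; field; lra |].
      rewrite S_INR. simpl pow. simpl pred. field. lra.
Qed.

Lemma flat_Cinf k : Cinf (fun _ => True) (flat k).
Proof.
  intros n. revert k. induction n as [| n IH]; intros k; [easy |].
  exists (fun x => flat (S (S k)) x + - INR k * flat (S k) x). split.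
  - intros s _. replace (_ + _) with (flat (S (S k)) s - INR k * flat (S k) s) by ring.
    apply flat_derive.
  - apply Cn_plus; [apply IH |]. apply Cn_mult; [apply Cn_const | apply IH].
Qed.

Lemma bump_exists x y : x < y -> exists beta, Cinf (fun _ => True) beta /\
  (forall s, x < s < y -> 0 < beta s) /\ (forall s, s < x \/ y < s -> beta s = 0).
Proof.
  intros H. exists (fun s => flat 0 (1 * s + - x) * flat 0 (-1 * s + y)). split; [| split].
  - intros n. apply Cn_mult; apply Cn_comp_affine, flat_Cinf.
  - intros s Hs. apply Rmult_lt_0_compat; apply flat_gt0; lra.
  - intros s [Hs | Hs].
    + rewrite (flat_neg 0 (1 * s + - x)) by lra. ring.
    + rewrite (flat_neg 0 (-1 * s + y)) by lra. ring.
Qed.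

(** Functions affine in t are stable under both partial derivatives: d/dt sends the pair (g, h) to
    (h, 0), and d/ds sends it to (g', h'). Hence induction on the word [w], with g and h general. *)
Lemma smooth2_affine a b eps w :
  forall g h F, Cinf (inI a b) g -> Cinf (inI a b) h ->
  (forall t s, dom a b eps t s -> F t s = g s + t * h s) ->
  exists g' h', Cinf (inI a b) g' /\ Cinf (inI a b) h' /\
    forall t s, dom a b eps t s -> pdw w F t s = g' s + t * h' s.
Proof.
  induction w as [| d w IH]; intros g h F Hg Hh HF; [now exists g, h |].
  assert (OI := inI_open a b).
  destruct d.
  - apply (IH h (fun _ => 0)); [exact Hh | intros n; apply Cn_const |].
    intros t s Hts. apply is_derive_unique.
    apply is_derive_ext_loc with (fun t => g s + t * h s).
    + eapply filter_imp; [| exact (open2_fst _ _ _ (dom_open a b eps) Hts)].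
      intros u Hu. symmetry. now apply HF.
    + auto_derive; [easy | ring].
  - destruct (Cinf_Derive _ _ OI Hg) as [G1 G2]. destruct (Cinf_Derive _ _ OI Hh) as [H1 H2].
    apply (IH (Derive g) (Derive h)); [exact G2 | exact H2 |].
    intros t s Hts. apply is_derive_unique.
    apply is_derive_ext_loc with (fun s => g s + t * h s).
    + eapply filter_imp; [| exact (open2_snd _ _ _ (dom_open a b eps) Hts)].
      intros u Hu. symmetry. now apply HF.
    + apply (is_derive_plus g (fun s => t * h s)); [apply G1, Hts |].
      apply (is_derive_scal h), H1, Hts.
Qed.

Lemma smooth2_affine_variation a b eps g h :
  Cinf (inI a b) g -> Cinf (inI a b) h ->
  smooth2 (fun t s => - eps < t < eps /\ inI a b s) (fun t s => g s + t * h s).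
Proof.
  intros Hg Hh w t s Hts. assert (OI := inI_open a b).
  destruct (smooth2_affine a b eps w g h _ Hg Hh (fun _ _ _ => eq_refl))
    as (g' & h' & Hg' & Hh' & E).
  destruct (Cinf_Derive _ _ OI Hg') as [G1 _]. destruct (Cinf_Derive _ _ OI Hh') as [H1 _].
  specialize (G1 s (proj2 Hts)). specialize (H1 s (proj2 Hts)).
  split; [| split].
  - apply (continuous_ext_open2 (dom a b eps) (fun t s => g' s + t * h' s)
             (pdw w (fun t s => g s + t * h s)) t s (dom_open a b eps) Hts).
    + intros u v Huv. symmetry. now apply E.
    + apply (continuous_plus (uc (fun _ s => g' s)) (uc (fun t s => t * h' s))).
      * apply (continuous_snd_lift g'), (ex_derive_continuous g'). eexists; exact G1.
      * apply (continuous_mult (uc (fun t _ => t)) (uc (fun _ s => h' s))).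
        -- apply (continuous_fst_lift (fun t => t)), continuous_id.
        -- apply (continuous_snd_lift h'), (ex_derive_continuous h'). eexists; exact H1.
  - exists (h' s). apply is_derive_ext_loc with (fun t => g' s + t * h' s).
    + eapply filter_imp; [| exact (open2_fst _ _ _ (dom_open a b eps) Hts)].
      intros u Hu. symmetry. now apply E.
    + auto_derive; [easy | ring].
  - eexists. apply is_derive_ext_loc with (fun s => g' s + t * h' s).
    + eapply filter_imp; [| exact (open2_snd _ _ _ (dom_open a b eps) Hts)].
      intros u Hu. symmetry. now apply E.
    + apply (is_derive_plus g' (fun s => t * h' s)); [exact G1 |].
      apply (is_derive_scal h'), H1.
Qed.

(** * Critical points and support functions *)

Lemma Dn_is_derive a b gamma :
  smooth_curve a b gamma -> forall n s, inI a b s ->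
  is_derive (fun u => fst (Dn n gamma u)) s (fst (Dn (S n) gamma s)) /\
  is_derive (fun u => snd (Dn n gamma u)) s (snd (Dn (S n) gamma s)).
Proof.
  intros H n s Hs. destruct (H (S n) s Hs) as [H1 H2].
  split; apply Derive_correct; assumption.
Qed.

Lemma Dn_Cinf a b gamma :
  smooth_curve a b gamma -> forall k,
  Cinf (inI a b) (fun u => fst (Dn k gamma u)) /\ Cinf (inI a b) (fun u => snd (Dn k gamma u)).
Proof.
  intros H k. split; apply Cinf_Derive_n; intros n s Hs; now apply H.
Qed.

Lemma locally_segment (P : R -> Prop) s :
  locally s P -> exists d, 0 < d /\ forall u, s - d <= u <= s + d -> P u.
Proof.
  intros [e He]. exists (e / 2). assert (H := cond_pos e). split; [lra |].
  intros u Hu. apply He. change (Rabs (u - s) < e). apply Rabs_def1; lra.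
Qed.

(** From gamma''' = -kappa gamma' and |T, N| = 1 one gets kappa = |gamma'', gamma'''| on the
    interval, a polynomial in derivatives of the smooth curve. *)
Lemma curv_deriv_kappa a b gamma kappa :
  smooth_curve a b gamma ->
  (forall s, inI a b s -> det (Dn 1 gamma s) (Dn 2 gamma s) = 1) ->
  (forall s, inI a b s -> Dn 3 gamma s = vscal (- kappa s) (Dn 1 gamma s)) ->
  curv_deriv a b kappa (Derive kappa) (Derive (Derive kappa)).
Proof.
  intros Hs H12 H3. assert (OI := inI_open a b).
  assert (HK : Cinf (inI a b) kappa).
  { intros n.
    apply (Cn_ext _ n (fun s => fst (Dn 2 gamma s) * snd (Dn 3 gamma s)
                                + (-1) * (snd (Dn 2 gamma s) * fst (Dn 3 gamma s)))).
    - exact OI.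
    - intros s Is. specialize (H12 s Is). rewrite (H3 s Is). unfold vscal, det in *.
      cbn [fst snd]. transitivity (kappa s * 1); [rewrite <- H12 |]; ring.
    - apply Cn_plus; [| apply Cn_mult; [apply Cn_const |]];
        apply Cn_mult; now apply (Dn_Cinf a b gamma). }
  destruct (Cinf_Derive _ _ OI HK) as [D1 HK1].
  destruct (Cinf_Derive _ _ OI HK1) as [D2 HK2].
  destruct (Cinf_Derive _ _ OI HK2) as [D3 _].
  intros s Is. split; [now apply D1 | split; [now apply D2 |]].
  apply (ex_derive_continuous (Derive (Derive kappa))). eexists. now apply D3.
Qed.

(** The variation is gamma + t beta N, and |beta N, T| = -beta. Being affine in t it is smooth for
    every t, so the bound 1 on t is an arbitrary choice. *)
Lemma bump_variation a b gamma x y :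
  smooth_curve a b gamma ->
  (forall s, inI a b s -> det (Dn 1 gamma s) (Dn 2 gamma s) = 1) ->
  inI a b x -> inI a b y -> x < y ->
  exists Gam beta, is_variation a b gamma 1 Gam x y /\
    (forall s, inI a b s -> det (vfield Gam s) (Dn 1 gamma s) = - beta s) /\
    (forall s, continuous beta s) /\ (forall s, x < s < y -> 0 < beta s).
Proof.
  intros Hs H12 Ix Iy Hxy.
  destruct (bump_exists x y Hxy) as (beta & Bc & Bp & Bo).
  assert (BI : Cinf (inI a b) beta) by (intros n; now apply (Cn_sub (fun _ => True))).
  exists (fun t s => (fst (gamma s) + t * (beta s * fst (Dn 2 gamma s)),
                      snd (gamma s) + t * (beta s * snd (Dn 2 gamma s)))), beta.
  split; [| split; [| split]].
  - split; [lra |]. split; [apply Ix |]. split; [lra |]. split; [apply Iy |].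
    destruct (Dn_Cinf a b gamma Hs 0) as [X0 Y0], (Dn_Cinf a b gamma Hs 2) as [X2 Y2].
    split; [| split; [| split]].
    + apply (smooth2_affine_variation a b 1 (fun u => fst (gamma u))
               (fun s => beta s * fst (Dn 2 gamma s))); [exact X0 |].
      intros n. now apply Cn_mult.
    + apply (smooth2_affine_variation a b 1 (fun u => snd (gamma u))
               (fun s => beta s * snd (Dn 2 gamma s))); [exact Y0 |].
      intros n. now apply Cn_mult.
    + intros s Is. rewrite !Rmult_0_l, !Rplus_0_r. symmetry. apply surjective_pairing.
    + intros t s Ht Is Os. rewrite (Bo s Os), !Rmult_0_l, !Rmult_0_r, !Rplus_0_r.
      symmetry. apply surjective_pairing.
  - intros s Is.
    assert (E : forall p q : R, Derive (fun t => p + t * q) 0 = q).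
    { intros p q. apply is_derive_unique. auto_derive; [easy | ring]. }
    unfold vfield, det. cbn [fst snd]. rewrite !E.
    specialize (H12 s Is). unfold det in H12.
    transitivity (- beta s * 1); [rewrite <- H12 |]; ring.
  - intros s. destruct (Bc 1%nat) as (f' & Hf & _).
    apply (ex_derive_continuous beta). eexists. now apply Hf.
  - exact Bp.
Qed.

(** The fundamental lemma of the calculus of variations: if the equation failed at s0, a bump
    supported near s0 would violate criticality. *)
Lemma constrained_critical_curvature a b gamma kappa k1 k2 lam :
  smooth_curve a b gamma ->
  (forall s, inI a b s -> det (Dn 1 gamma s) (Dn 2 gamma s) = 1) ->
  (forall s, inI a b s -> Dn 3 gamma s = vscal (- kappa s) (Dn 1 gamma s)) ->
  curv_deriv a b kappa k1 k2 ->
  (forall eps Gam x y, is_variation a b gamma eps Gam x y ->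
     delta_TotCurv Gam x y = lam * delta_Area Gam x y) ->
  forall s, inI a b s -> k2 s + kappa s ^ 2 = - (3/2) * lam.
Proof.
  intros Hs H12 H3 Hk Hc s0 I0.
  set (h := fun s => k2 s + kappa s ^ 2).
  destruct (Req_dec (h s0 + 3/2 * lam) 0) as [E | E]; [unfold h in E; lra | exfalso].
  (* Multiplying the deviation by its own value at s0 makes it positive near s0 whatever its sign,
     which avoids two symmetric cases. *)
  set (g := fun s => (h s0 + 3/2 * lam) * (h s + 3/2 * lam)).
  assert (Ch : forall s, inI a b s -> continuous h s).
  { intros s Is. destruct (Hk s Is) as (A1 & A2 & A3).
    apply (continuous_plus k2 (fun s => kappa s ^ 2)); [exact A3 |].
    apply (continuous_comp kappa (fun z => z ^ 2)).
    - apply (ex_derive_continuous kappa). now exists (k1 s).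
    - apply (ex_derive_continuous (fun z : R => z ^ 2)). auto_derive; auto. }
  assert (Cg : forall s, inI a b s -> continuous g s).
  { intros s Is. apply (continuous_scal_r (h s0 + 3/2 * lam : R_AbsRing) (fun s => h s + 3/2 * lam)).
    apply (continuous_plus h (fun _ => 3/2 * lam)); [now apply Ch | apply continuous_const]. }
  assert (L : locally s0 (fun s => inI a b s /\ 0 < g s)).
  { apply filter_and; [now apply inI_open |].
    apply (Cg s0 I0 (fun z => 0 < z)), open_gt. unfold g. nra. }
  destruct (locally_segment _ _ L) as (d & Hd & HL).
  set (x := s0 - d). set (y := s0 + d).
  assert (Hxy : x < y) by (unfold x, y; lra).
  assert (HI : forall s, x <= s <= y -> inI a b s) by (intros s Hsx; now apply HL).
  destruct (bump_variation a b gamma x y Hs H12) as (Gam & beta & HV & Hm & Bc & Bp);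
    [apply HI; lra | apply HI; lra | exact Hxy |].
  destruct (first_variation a b gamma kappa k1 k2 1 Gam x y H12 H3 Hk HV) as (_ & E1 & E2).
  specialize (Hc _ _ _ _ HV). rewrite E1, E2 in Hc.
  rewrite (RInt_ext (fun s => det (vfield Gam s) (Dn 1 gamma s)) (fun s => - beta s)) in Hc.
  2: { rewrite Rmin_left, Rmax_right by lra. intros s Hsx. apply Hm, HI; lra. }
  rewrite (RInt_ext (fun s => (k2 s + kappa s ^ 2) * det (vfield Gam s) (Dn 1 gamma s))
             (fun s => h s * - beta s)) in Hc.
  2: { rewrite Rmin_left, Rmax_right by lra. intros s Hsx. unfold h.
       rewrite Hm; [reflexivity | apply HI; lra]. }
  assert (Cb : forall s, continuous (fun s => - beta s) s).
  { intros s. apply (continuous_opp beta), Bc. }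
  assert (I1 : ex_RInt (fun s => - beta s) x y).
  { apply (@ex_RInt_continuous R_CompleteNormedModule). intros s _. apply Cb. }
  assert (I2 : ex_RInt (fun s => h s * - beta s) x y).
  { apply (@ex_RInt_continuous R_CompleteNormedModule).
    rewrite Rmin_left, Rmax_right by lra. intros s Hsx.
    apply (continuous_mult h (fun s => - beta s)); [now apply Ch, HI | apply Cb]. }
  apply (@RInt_correct R_CompleteNormedModule) in I1.
  apply (@RInt_correct R_CompleteNormedModule) in I2.
  set (A := RInt (fun s => - beta s) x y) in *.
  set (M := RInt (fun s => h s * - beta s) x y) in *.
  assert (P : 0 < RInt (fun s => g s * beta s) x y).
  { apply RInt_gt_0; [exact Hxy | |].
    - intros s Hsx. apply Rmult_lt_0_compat; [apply HL; unfold x, y in Hsx; lra | now apply Bp].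
    - intros s Hsx. apply (continuous_mult g beta); [now apply Cg, HI | apply Bc]. }
  (* The positive integral of g beta is a combination of [M] and [A] that vanishes, because
     criticality says -2/3 M = lam A. *)
  assert (Z : is_RInt (fun s => g s * beta s) x y
            (plus (scal (- (h s0 + 3/2 * lam)) M) (scal (- (h s0 + 3/2 * lam) * (3/2 * lam)) A))).
  { apply (is_RInt_ext (fun s => plus (scal (- (h s0 + 3/2 * lam)) (h s * - beta s))
              (scal (- (h s0 + 3/2 * lam) * (3/2 * lam)) (- beta s)))).
    - intros s _. unfold plus, scal, g; simpl. unfold mult; simpl. ring.
    - apply (is_RInt_plus (V := R_NormedModule)); apply (is_RInt_scal (V := R_NormedModule));
        assumption. }
  rewrite (is_RInt_unique _ _ _ _ Z) in P.
  change (0 < - (h s0 + 3/2 * lam) * M + - (h s0 + 3/2 * lam) * (3/2 * lam) * A) in P.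
  replace M with (- (3/2) * (lam * A)) in P by lra.
  ring_simplify in P. lra.
Qed.

Lemma delta_TotCurv_of_const a b gamma kappa k1 k2 mu eps Gam x y :
  (forall s, inI a b s -> det (Dn 1 gamma s) (Dn 2 gamma s) = 1) ->
  (forall s, inI a b s -> Dn 3 gamma s = vscal (- kappa s) (Dn 1 gamma s)) ->
  curv_deriv a b kappa k1 k2 ->
  (forall s, inI a b s -> k2 s + kappa s ^ 2 = mu) ->
  is_variation a b gamma eps Gam x y ->
  delta_TotCurv Gam x y = - (2/3) * mu * delta_Area Gam x y.
Proof.
  intros H12 H3 Hk Hmu HV.
  destruct (first_variation a b gamma kappa k1 k2 eps Gam x y H12 H3 Hk HV) as (Im & -> & ->).
  destruct HV as (_ & Hax & Hxy & Hyb & _).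
  rewrite Rmult_assoc. f_equal.
  etransitivity; [| exact (RInt_scal (V := R_CompleteNormedModule) _ x y mu Im)].
  apply RInt_ext. rewrite Rmin_left, Rmax_right by lra. intros s Hs.
  rewrite Hmu; [reflexivity |]. split.
  - apply Rbar_lt_le_trans with x; [exact Hax | apply Rlt_le, Hs].
  - apply Rbar_le_lt_trans with y; [apply Rlt_le, Hs | exact Hyb].
Qed.

(** The bump field gives delta Area = - int beta < 0, so the proportional variation of total
    curvature cannot vanish when mu is nonzero. *)
Lemma not_unconstrained_of_const a b gamma kappa k1 k2 mu :
  Rbar_lt a b ->
  smooth_curve a b gamma ->
  (forall s, inI a b s -> det (Dn 1 gamma s) (Dn 2 gamma s) = 1) ->
  (forall s, inI a b s -> Dn 3 gamma s = vscal (- kappa s) (Dn 1 gamma s)) ->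
  curv_deriv a b kappa k1 k2 ->
  (forall s, inI a b s -> k2 s + kappa s ^ 2 = mu) ->
  mu <> 0 -> ~ unconstrained_critical a b gamma.
Proof.
  intros Hab Hs H12 H3 Hk Hmu Hmu0 Hu.
  destruct (inI_inhabited a b Hab) as [s0 I0].
  destruct (locally_segment _ _ (inI_open a b s0 I0)) as (d & Hd & HI).
  assert (Hxy : s0 - d < s0 + d) by lra.
  destruct (bump_variation a b gamma (s0 - d) (s0 + d) Hs H12)
    as (Gam & beta & HV & Hm & Bc & Bp); [apply HI; lra | apply HI; lra | exact Hxy |].
  specialize (Hu _ _ _ _ HV).
  rewrite (delta_TotCurv_of_const a b gamma kappa k1 k2 mu 1 Gam _ _ H12 H3 Hk Hmu HV) in Hu.
  destruct (first_variation a b gamma kappa k1 k2 1 Gam _ _ H12 H3 Hk HV) as (_ & _ & EA).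
  assert (P := RInt_gt_0 beta _ _ Hxy Bp (fun s _ => Bc s)).
  rewrite (RInt_ext _ (fun s => opp (beta s))) in EA.
  2: { rewrite Rmin_left, Rmax_right by lra. intros s Is. apply Hm, HI; lra. }
  rewrite (RInt_opp (V := R_CompleteNormedModule)) in EA.
  2: { apply (@ex_RInt_continuous R_CompleteNormedModule). intros s _. apply Bc. }
  change (delta_Area Gam (s0 - d) (s0 + d) = - RInt beta (s0 - d) (s0 + d)) in EA.
  rewrite EA in Hu.
  apply Rmult_integral in Hu. lra.
Qed.

(* The centre is [gamma + rho N - rho' T] with [rho = kappa / mu]; its
   derivative is [(1 - rho'' - kappa rho) T]. *)
Lemma centre_exists a b gamma kappa k1 k2 mu :
  Rbar_lt a b ->
  smooth_curve a b gamma ->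
  (forall s, inI a b s -> det (Dn 1 gamma s) (Dn 2 gamma s) = 1) ->
  (forall s, inI a b s -> Dn 3 gamma s = vscal (- kappa s) (Dn 1 gamma s)) ->
  curv_deriv a b kappa k1 k2 ->
  (forall s, inI a b s -> k2 s + kappa s ^ 2 = mu) ->
  mu <> 0 ->
  exists O : R2, forall s, inI a b s -> support_fn O gamma s = / mu * kappa s.
Proof.
  intros Hab Hs H12 H3 Hk Hmu Hmu0.
  destruct (inI_inhabited a b Hab) as [s0 I0].
  (* Stated for one scalar chain of derivatives, so that it applies to each coordinate of the
     candidate centre. *)
  assert (const : forall X0 X1 X2 X3 : R -> R,
     (forall s, inI a b s -> is_derive X0 s (X1 s) /\ is_derive X1 s (X2 s) /\
        is_derive X2 s (X3 s) /\ X3 s = - kappa s * X1 s) ->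
     exists o, forall s, inI a b s -> X0 s + / mu * kappa s * X2 s - / mu * k1 s * X1 s = o).
  { intros X0 X1 X2 X3 HX.
    set (c := fun s => X0 s + / mu * kappa s * X2 s - / mu * k1 s * X1 s).
    assert (Dc : forall s, inI a b s -> is_derive c s 0).
    { intros s Is. destruct (HX s Is) as (A0 & A1 & A2 & E3). destruct (Hk s Is) as (B0 & B1 & _).
      unfold c. auto_derive; [repeat split; eexists; eassumption |].
      rewrite_derive A0; rewrite_derive A1; rewrite_derive A2.
      rewrite_derive B0; rewrite_derive B1. rewrite E3.
      replace (k2 s) with (mu - kappa s ^ 2) by (rewrite <- (Hmu s Is); ring).
      field. exact Hmu0. }
    exists (c s0). intros s Is.
    destruct (Rtotal_order s s0) as [H | [-> | H]]; [| reflexivity |].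
    - apply (eq_is_derive c); [| exact H]. intros t Ht.
      apply Dc, (inI_between a b s s0); assumption.
    - symmetry. apply (eq_is_derive c); [| exact H]. intros t Ht.
      apply Dc, (inI_between a b s0 s); assumption. }
  assert (E3 : forall s, inI a b s -> fst (Dn 3 gamma s) = - kappa s * fst (Dn 1 gamma s) /\
                                      snd (Dn 3 gamma s) = - kappa s * snd (Dn 1 gamma s)).
  { intros s Is. rewrite (H3 s Is). split; reflexivity. }
  destruct (const (fun s => fst (Dn 0 gamma s)) (fun s => fst (Dn 1 gamma s))
              (fun s => fst (Dn 2 gamma s)) (fun s => fst (Dn 3 gamma s))) as [o1 HO1].
  { intros s Is.
    exact (conj (proj1 (Dn_is_derive a b gamma Hs 0 s Is))
            (conj (proj1 (Dn_is_derive a b gamma Hs 1 s Is))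
              (conj (proj1 (Dn_is_derive a b gamma Hs 2 s Is)) (proj1 (E3 s Is))))). }
  destruct (const (fun s => snd (Dn 0 gamma s)) (fun s => snd (Dn 1 gamma s))
              (fun s => snd (Dn 2 gamma s)) (fun s => snd (Dn 3 gamma s))) as [o2 HO2].
  { intros s Is.
    exact (conj (proj2 (Dn_is_derive a b gamma Hs 0 s Is))
            (conj (proj2 (Dn_is_derive a b gamma Hs 1 s Is))
              (conj (proj2 (Dn_is_derive a b gamma Hs 2 s Is)) (proj2 (E3 s Is))))). }
  exists (o1, o2). intros s Is. specialize (HO1 s Is). specialize (HO2 s Is).
  specialize (H12 s Is). unfold support_fn, vsub. unfold det in *. cbn [fst snd].
  change (fst (gamma s)) with (fst (Dn 0 gamma s)).
  change (snd (gamma s)) with (snd (Dn 0 gamma s)).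
  (* Now gamma - O = - rho N + rho' T, hence |gamma - O, T| = rho |T, N| = rho. *)
  rewrite <- HO1, <- HO2.
  transitivity (/ mu * kappa s * 1); [rewrite <- H12 |]; ring.
Qed.

(* Twice differentiating the support function gives [rho'' = 1 - kappa rho]. *)
Lemma support_curvature_equation a b gamma kappa k1 k2 O c :
  smooth_curve a b gamma ->
  (forall s, inI a b s -> det (Dn 1 gamma s) (Dn 2 gamma s) = 1) ->
  (forall s, inI a b s -> Dn 3 gamma s = vscal (- kappa s) (Dn 1 gamma s)) ->
  curv_deriv a b kappa k1 k2 ->
  (forall s, inI a b s -> support_fn O gamma s = c * kappa s) ->
  forall s, inI a b s -> c * (k2 s + kappa s ^ 2) = 1.
Proof.
  intros Hs H12 H3 Hk Hc.
  assert (uniq : forall (f g : R -> R) (l m : R) s, inI a b s ->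
            (forall s, inI a b s -> f s = g s) -> is_derive f s l -> is_derive g s m -> l = m).
  { intros f g l m s Is E Hf Hg. rewrite <- (is_derive_unique _ _ _ Hf).
    apply is_derive_unique. apply is_derive_ext_loc with g; [| exact Hg].
    eapply filter_imp; [| exact (inI_open _ _ _ Is)]. intros u Iu. symmetry. now apply E. }
  set (X := fun n s => fst (Dn n gamma s)). set (Y := fun n s => snd (Dn n gamma s)).
  assert (dX : forall n s, inI a b s -> is_derive (X n) s (X (S n) s))
    by (intros n s Is; exact (proj1 (Dn_is_derive a b gamma Hs n s Is))).
  assert (dY : forall n s, inI a b s -> is_derive (Y n) s (Y (S n) s))
    by (intros n s Is; exact (proj2 (Dn_is_derive a b gamma Hs n s Is))).
  assert (E12 : forall s, inI a b s -> X 1%nat s * Y 2%nat s - Y 1%nat s * X 2%nat s = 1)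
    by exact H12.
  assert (E3 : forall s, inI a b s -> X 3%nat s = - kappa s * X 1%nat s /\
                                      Y 3%nat s = - kappa s * Y 1%nat s).
  { intros s Is. unfold X, Y. rewrite (H3 s Is). split; reflexivity. }
  (* [P n] is |gamma - O, gamma^(n)|, so [P 1] is rho. Its derivative is |T, gamma^(n)| + [P (n+1)],
     whose first term is 0 for n = 1 and 1 for n = 2; thus [P 2] = rho', and rho'' = 1 + [P 3] with
     [P 3] = - kappa rho. *)
  set (P := fun n s => (X 0%nat s - fst O) * Y n s - (Y 0%nat s - snd O) * X n s).
  assert (dP : forall n s, inI a b s ->
            is_derive (P n) s (X 1%nat s * Y n s - Y 1%nat s * X n s + P (S n) s)).
  { intros n s Is. unfold P.
    assert (A0 := dX 0%nat s Is). assert (A1 := dX n s Is).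
    assert (B0 := dY 0%nat s Is). assert (B1 := dY n s Is).
    clearbody X Y. auto_derive; [repeat split; eexists; eassumption |].
    rewrite_derive A0; rewrite_derive A1; rewrite_derive B0; rewrite_derive B1. ring. }
  assert (E1 : forall s, inI a b s -> P 1%nat s = c * kappa s) by exact Hc.
  assert (E2 : forall s, inI a b s -> P 2%nat s = c * k1 s).
  { intros s Is. destruct (Hk s Is) as (A & _).
    assert (Q := uniq _ (fun s => c * kappa s) _ _ s Is E1 (dP 1%nat s Is)
                   (is_derive_scal kappa s c _ A)).
    lra. }
  intros s Is. destruct (Hk s Is) as (_ & A & _).
  assert (Q := uniq _ (fun s => c * k1 s) _ _ s Is E2 (dP 2%nat s Is)
                 (is_derive_scal k1 s c _ A)).
  rewrite (E12 s Is) in Q.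
  replace (P 3%nat s) with (- kappa s * P 1%nat s) in Q.
  - rewrite (E1 s Is) in Q. lra.
  - unfold P. destruct (E3 s Is) as [-> ->]. ring.
Qed.

Theorem theorem3 (a b : Rbar) (gamma : R -> R2) (kappa : R -> R) :
  Rbar_lt a b ->
  smooth_curve a b gamma ->
  (forall s, inI a b s -> det (Dn 1 gamma s) (Dn 2 gamma s) = 1) ->
  (forall s, inI a b s -> Dn 3 gamma s = vscal (- kappa s) (Dn 1 gamma s)) ->
  (constrained_critical a b gamma /\ ~ unconstrained_critical a b gamma) <->
  exists (O : R2) (c : R), c <> 0 /\
    forall s, inI a b s -> support_fn O gamma s = c * kappa s.
Proof.
  intros Hab Hs H12 H3. assert (Hk := curv_deriv_kappa a b gamma kappa Hs H12 H3).
  split.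
  - intros [[lam Hlam] Hnu].
    (* A zero multiplier would make every first variation of total curvature vanish. *)
    assert (Hl : lam <> 0).
    { intros ->. apply Hnu. intros eps Gam x y HV. rewrite (Hlam _ _ _ _ HV). ring. }
    assert (Hmu := constrained_critical_curvature a b gamma kappa _ _ lam Hs H12 H3 Hk Hlam).
    destruct (centre_exists a b gamma kappa _ _ _ Hab Hs H12 H3 Hk Hmu) as [O HO]; [lra |].
    exists O, (/ (- (3/2) * lam)). split; [apply Rinv_neq_0_compat; lra | exact HO].
  - intros (O & c & Hc0 & HO).
    assert (Hmu : forall s, inI a b s -> Derive (Derive kappa) s + kappa s ^ 2 = / c).
    { intros s Is.
      assert (E := support_curvature_equation a b gamma kappa _ _ O c Hs H12 H3 Hk HO s Is).
      apply Rmult_eq_reg_l with c; [| exact Hc0]. rewrite E. field. exact Hc0. }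
    split.
    + exists (- (2/3) * / c). intros eps Gam x y HV.
      now apply (delta_TotCurv_of_const a b gamma kappa _ _ (/ c) eps Gam x y H12 H3 Hk Hmu).
    + apply (not_unconstrained_of_const a b gamma kappa _ _ (/ c) Hab Hs H12 H3 Hk Hmu).
      now apply Rinv_neq_0_compat.
Qed.
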